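(* Let $m\ge1$ be an integer and let $\boldsymbol a_1,\boldsymbol a_2,\boldsymbol b_1,\boldsymbol b_2$ be (finite) real tuples of sizes $i_1,i_2,j_1,j_2$, where no entry of $\boldsymbol a_1$ or $\boldsymbol a_2$ lies in $\{0,\frac1m,\dots,\frac{m-1}m\}$. Then $$\mathcal H_m^E\left[\begin{smallmatrix}\boldsymbol b_1\\ \boldsymbol a_1\end{smallmatrix}\right]\boxtimes_{2m}\mathcal H_m^E\left[\begin{smallmatrix}\boldsymbol b_2\\ \boldsymbol a_2\end{smallmatrix}\right]=\mathcal H_m^E\left[\begin{smallmatrix}-\frac1{2m},\ \boldsymbol b_1,\ \boldsymbol b_2\\ 1-\frac1{2m},\ \boldsymbol a_1,\ \boldsymbol a_2\end{smallmatrix}\right].$$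
   Context: $\mathcal P_n$ is the set of monic polynomials of degree $n$ over $\mathbb C$. For $p\in\mathcal P_n$ the coefficients $\mathsf e_k(p)$ are defined by $p(x)=\sum_{k=0}^n x^{n-k}(-1)^k\mathsf e_k(p)$. Falling factorial: $(a)^{\underline k}=a(a-1)\cdots(a-k+1)$; for tuples it denotes the product over the entries (equal to $1$ for the empty tuple), and $n\boldsymbol a$ denotes entrywise multiplication. Hypergeometric polynomials: for a real tuple $\boldsymbol b$ and a real tuple $\boldsymbol a$ with no entry in $\{0,\frac1m,\dots,\frac{m-1}m\}$, $\mathcal H_m\left[\begin{smallmatrix}\boldsymbol b\\ \boldsymbol a\end{smallmatrix}\right]\in\mathcal P_m$ is the monic polynomial with $\mathsf e_k=\binom mk\frac{(m\boldsymbol b)^{\underline k}}{(m\boldsymbol a)^{\underline k}}$, $0\le k\le m$. Its even version is $\mathcal H_m^E\left[\begin{smallmatrix}\boldsymbol b\\ \boldsymbol a\end{smallmatrix}\right](x)=\mathcal H_m\left[\begin{smallmatrix}\boldsymbol b\\ \boldsymbol a\end{smallmatrix}\right](x^2)\in\mathcal P_{2m}$. A comma inside the bracket denotes concatenation of parameters. Finite free multiplicative convolution on $\mathcal P_n$: $\mathsf e_k(p\boxtimes_n q)=\binom nk^{-1}\mathsf e_k(p)\mathsf e_k(q)$ for $0\le k\le n$. *)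

(* Defs.v *)
From HB Require Import structures.
From mathcomp Require Import all_boot all_order all_algebra.
From mathcomp Require Import reals.
From mathcomp.real_closed Require Import complex.
From mathcomp Require Import ring lra.

Set Implicit Arguments.
Unset Strict Implicit.
Unset Printing Implicit Defensive.

Import Order.TTheory GRing.Theory Num.Theory.
Local Open Scope ring_scope.
Local Open Scope complex_scope.

(* The complex numbers are R[i] with R : realType; a real number x is sent   *)
(* to R[i] by x%:C.  The set P_n is cut out by the predicate monic_deg n.     *)

Section FiniteFree.
Variable R : realType.
Implicit Types (p q : {poly R[i]}) (a b : seq R) (e : nat -> R[i]).

Definition monic_deg (n : nat) p : bool := (p \is monic) && (size p == n.+1).

(* The sign is its own inverse: (-1)^k ecoef n p k is the coefficient of     *)
(* x^(n-k).  Meaningful for k <= n and p in P_n.                             *)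
Definition ecoef (n : nat) p (k : nat) : R[i] := (-1) ^+ k * p`_(n - k).

Definition poly_of_ecoef (n : nat) e : {poly R[i]} :=
  \sum_(k < n.+1) ((-1) ^+ k * e k) *: 'X^(n - k).

Definition ff_mul (n : nat) p q : {poly R[i]} :=
  poly_of_ecoef n (fun k => ('C(n, k)%:R)^-1 * ecoef n p k * ecoef n q k).

Definition falling (x : R) (k : nat) : R := \prod_(i < k) (x - i%:R).

Definition falling_seq a (k : nat) : R := \prod_(x <- a) falling x k.

Definition scale_seq (n : nat) a : seq R := [seq n%:R * x | x <- a].

Definition admissible (m : nat) a : Prop :=
  forall x, x \in a -> forall i : 'I_m, x != i%:R / m%:R.

(* Upper parameters b first, lower parameters a second.  Meaningful when a   *)
(* is admissible; otherwise the division by zero yields a junk value.        *)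
Definition hypergeo (m : nat) b a : {poly R[i]} :=
  poly_of_ecoef m (fun k =>
    ('C(m, k)%:R * falling_seq (scale_seq m b) k
                 / falling_seq (scale_seq m a) k)%:C).

Definition hypergeoE (m : nat) b a : {poly R[i]} := hypergeo m b a \Po 'X^2.

Lemma coef_poly_of_ecoef n e k : (k <= n)%N ->
  (poly_of_ecoef n e)`_(n - k) = (-1) ^+ k * e k.
Proof.
move=> kn; rewrite /poly_of_ecoef coef_sum.
rewrite (bigD1 (inord k : 'I_n.+1)) //= inordK ?ltnS //.
rewrite coefZ coefXn eqxx mulr1 big1 ?addr0 // => i ik.
rewrite coefZ coefXn; case: eqP => [h|_]; last by rewrite mulr0.
case/eqP: ik; apply/val_inj; rewrite /= inordK ?ltnS //.
by have := ltn_ord i; rewrite ltnS => li; rewrite -(subKn li) -h subKn.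
Qed.

Lemma ecoef_poly_of_ecoef n e k : (k <= n)%N ->
  ecoef n (poly_of_ecoef n e) k = e k.
Proof. by move=> kn; rewrite /ecoef coef_poly_of_ecoef // signrMK. Qed.

Lemma ecoefK n p : monic_deg n p -> poly_of_ecoef n (ecoef n p) = p.
Proof.
case/andP=> _ /eqP sp; apply/polyP => i.
have [ile|ilt] := leqP i n.
  by rewrite -(subKn ile) coef_poly_of_ecoef ?leq_subr // /ecoef signrMK.
rewrite [RHS]nth_default ?sp // /poly_of_ecoef coef_sum big1 // => j _.
rewrite coefZ coefXn gtn_eqF ?mulr0 //.
by apply: leq_ltn_trans ilt; apply: leq_subr.
Qed.

Lemma monic_deg_poly_of_ecoef n e : e 0%N = 1 -> monic_deg n (poly_of_ecoef n e).
Proof.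
move=> e0.
have cn : (poly_of_ecoef n e)`_n = 1.
  by rewrite -[n in _`_n]subn0 coef_poly_of_ecoef // e0 mulr1.
have sp : size (poly_of_ecoef n e) = n.+1.
  apply/eqP; rewrite eqn_leq; apply/andP; split.
    apply/leq_sizeP => j nj; rewrite coef_sum big1 // => i _.
    rewrite coefZ coefXn gtn_eqF ?mulr0 //.
    by apply: leq_ltn_trans nj; apply: leq_subr.
  rewrite ltnNge; apply/negP => /leq_sizeP /(_ n (leqnn n)) /eqP.
  by rewrite cn oner_eq0.
by rewrite /monic_deg sp eqxx andbT monicE lead_coefE sp cn.
Qed.

Lemma falling_seq0 a : falling_seq a 0 = 1.
Proof. by rewrite /falling_seq big1_seq // => x _; rewrite /falling big_ord0. Qed.

Lemma falling_seq_neq0 m a k : (0 < m)%N -> admissible m a -> (k <= m)%N ->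
  falling_seq (scale_seq m a) k != 0.
Proof.
move=> m0 ha km; rewrite /falling_seq /scale_seq big_map prodf_seq_neq0.
apply/allP => x xa /=; apply/prodf_neq0 => i _; rewrite subr_eq0.
have mz : m%:R != 0 :> R by rewrite pnatr_eq0 -lt0n.
apply: contra (ha x xa (widen_ord km i)) => /eqP /= <-.
by rewrite mulrAC divff // mul1r.
Qed.

Lemma monic_deg_hypergeo m b a : monic_deg m (hypergeo m b a).
Proof.
by apply: monic_deg_poly_of_ecoef; rewrite !falling_seq0 bin0 invr1 !mulr1.
Qed.

Lemma monic_deg_hypergeoE m b a : monic_deg (2 * m) (hypergeoE m b a).
Proof.
have /andP[mo /eqP sz] := monic_deg_hypergeo m b a.
have s2 : size ('X^2 : {poly R[i]}) = 3 by rewrite size_polyXn.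
rewrite /monic_deg /hypergeoE monicE lead_coef_comp ?s2 // (monicP mo).
rewrite lead_coefXn expr1n mulr1 eqxx /=.
have := size_comp_poly (hypergeo m b a) 'X^2; rewrite sz s2 /= mulnC => <-.
rewrite prednK ?eqxx // lt0n size_poly_eq0 -lead_coef_eq0 lead_coef_comp ?s2 //.
by rewrite (monicP mo) lead_coefXn expr1n mulr1 oner_eq0.
Qed.

Lemma monic_deg_ff_mul n p q :
  monic_deg n p -> monic_deg n q -> monic_deg n (ff_mul n p q).
Proof.
move=> /andP[/monicP mp /eqP sp] /andP[/monicP mq /eqP sq].
move: mp mq; rewrite !lead_coefE sp sq /= => mp mq.
apply: monic_deg_poly_of_ecoef.
by rewrite /ecoef subn0 mp mq bin0 invr1 !mulr1.
Qed.

Lemma admissible_cat m a1 a2 : (0 < m)%N -> admissible m a1 -> admissible m a2 ->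
  admissible m ((1 - 1 / (2 * m)%:R) :: a1 ++ a2).
Proof.
move=> m0 h1 h2 x; rewrite inE mem_cat => /orP[/eqP ->|/orP[/h1|/h2]] // i.
have mz : 0 < m%:R :> R by rewrite ltr0n.
have im : i%:R + 1 <= m%:R :> R by rewrite natr1 ler_nat.
rewrite natrM; apply/eqP => h.
have : (1 - 1 / (2 * m%:R)) * m%:R = i%:R / m%:R * m%:R :> R by rewrite h.
rewrite mulfVK ?lt0r_neq0 // => h2'.
have : (1 - 1 / (2 * m%:R)) * m%:R = m%:R - 1 / 2 :> R by field; lra.
lra.
Qed.

End FiniteFree.

(* Main.v *)
Require Import Defs.
From mathcomp Require Import all_boot all_order all_algebra.
From mathcomp Require Import reals.
From mathcomp.real_closed Require Import complex.
From mathcomp Require Import ring lra.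

Import GRing.Theory Num.Theory.
Local Open Scope ring_scope.

(** Write e_k for the signed coefficient [ecoef] of index k and (x)_k for the
    falling factorial.  A monic polynomial of degree 2m is determined by its
    e_k, so both sides are compared index by index.  Substituting x^2 makes the
    odd e_k vanish and turns e_k of a hypergeometric polynomial into
    e_(2k) = (-1)^k e_k ([ecoef_hypergeoE]).  At odd indices both sides are
    therefore zero.  At index 2k the contributions of a1, a2, b1, b2 agree,
    because [falling_seq] turns concatenation into product.  Multiplied by m,
    the two extra parameters are -1/2 and m - 1/2, and what remains is

      C(2m, 2k) (-1)^k (-1/2)_k = C(m, k) (m - 1/2)_k,

    which is [bin_double_falling], proved by induction on k from the recurrence
    of the binomial coefficients in their lower index. *)

(** The subtraction is taken in the ring, so that no bound on k is needed. *)
Lemma natr_binS (A : pzRingType) n k :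
  k.+1%:R * 'C(n, k.+1)%:R = (n%:R - k%:R) * 'C(n, k)%:R :> A.
Proof.
have [kn|nk] := leqP k n; first by rewrite -natrB // -!natrM mul_bin_left.
by rewrite !bin_small ?mulr0 // ltnW.
Qed.

Section FallingFactorials.
Variable R : realType.
Implicit Types (a b : seq R) (x : R).

Lemma fallingS x k : falling x k.+1 = falling x k * (x - k%:R).
Proof. by rewrite /falling big_ord_recr. Qed.

Lemma falling_scale_cons n x a k :
  falling_seq (scale_seq n (x :: a)) k
  = falling (n%:R * x) k * falling_seq (scale_seq n a) k.
Proof. by rewrite /falling_seq /= big_cons. Qed.

Lemma falling_scale_cat n a b k :
  falling_seq (scale_seq n (a ++ b)) k
  = falling_seq (scale_seq n a) k * falling_seq (scale_seq n b) k.
Proof. by rewrite /falling_seq /scale_seq map_cat big_cat. Qed.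

Lemma bin_double_falling m k :
  'C(2 * m, 2 * k)%:R * ((-1) ^+ k * falling (- (1 / 2)) k)
  = 'C(m, k)%:R * falling (m%:R - 1 / 2) k :> R.
Proof.
elim: k => [|k IHk].
  by rewrite muln0 !bin0 expr0 /falling !big_ord0 !mulr1.
rewrite mulnS add2n !fallingS exprS.
have := natr_binS R m k; have := natr_binS R (2 * m) (2 * k).
have := natr_binS R (2 * m) (2 * k).+1; move: IHk (ler0n R k).
rewrite -(natr1 (2 * k).+1) -(natr1 (2 * k)) -(natr1 k) !natrM.
(* From here on everything is an identity between field elements: K and M are
   k and m, B0 and B1 are C(m, k) and C(m, k+1), D0, D1 and D2 are C(2m, 2k),
   C(2m, 2k+1) and C(2m, 2k+2), and f, g, s are the factors of [IHk]. *)
move: (falling (m%:R - 1 / 2) k) (falling (- (1 / 2)) k) => g f.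
move: (m%:R : R) (k%:R : R) ((-1) ^+ k : R).
move: ('C(m, k)%:R : R) ('C(m, k.+1)%:R : R) ('C(_, 2 * k)%:R : R).
move: ('C(_, (2 * k).+1)%:R : R) ('C(_, (2 * k).+2)%:R : R).
move=> D1 D2 B0 B1 D0 M K s IHk K0 h3 h2 h1.
have u : (K + 1) * (2 * K + 1) != 0 by rewrite mulf_neq0 ?lt0r_neq0 //; lra.
(* Both sides are multiplied by (k + 1) (2k + 1) to apply the recurrences. *)
apply: (mulfI u).
have e : (2 * K + 1) * (K + 1) * D2 = (M - K) * (2 * M - 2 * K - 1) * D0.
  have -> : (2 * K + 1) * (K + 1) * D2 = (2 * K + 1) * ((2 * K + 1 + 1) * D2) / 2.
    by field.
  rewrite h3.
  have -> : (2 * K + 1) * ((2 * M - (2 * K + 1)) * D1) / 2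
          = (2 * M - (2 * K + 1)) * ((2 * K + 1) * D1) / 2 by ring.
  by rewrite h2; field.
transitivity ((2 * K + 1) * (K + 1) * D2 * s * f * (1 / 2 + K)); first by ring.
rewrite e.
transitivity ((M - K) * (2 * M - 2 * K - 1) * (1 / 2 + K) * (D0 * (s * f))).
  by ring.
rewrite IHk.
transitivity ((2 * K + 1) * ((K + 1) * B1) * g * (M - 1 / 2 - K)); last by ring.
by rewrite h1; field.
Qed.

(** The ratio [c] is the contribution of the parameters -1/(2m) and 1 - 1/(2m)
    to e_k of the hypergeometric polynomial on the right-hand side. *)
Lemma falling_extra_params m k : (0 < m)%N -> (k <= m)%N ->
  let c := falling (m%:R * - (1 / (2 * m)%:R)) k
         / falling (m%:R * (1 - 1 / (2 * m)%:R)) k : R in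
  'C(2 * m, 2 * k)%:R^-1 * 'C(m, k)%:R = (-1) ^+ k * c.
Proof.
move=> m0 km /=.
have mz : m%:R != 0 :> R by rewrite pnatr_eq0 -lt0n.
have -> : m%:R * - (1 / (2 * m)%:R) = - (1 / 2) :> R.
  by rewrite natrM; field.
have -> : m%:R * (1 - 1 / (2 * m)%:R) = m%:R - 1 / 2 :> R.
  by rewrite natrM; field.
have Cz : 'C(2 * m, 2 * k)%:R != 0 :> R.
  by rewrite pnatr_eq0 -lt0n bin_gt0 leq_mul2l km orbT.
have := bin_double_falling m k.
have gz : falling (m%:R - 1 / 2 : R) k != 0.
  apply/prodf_neq0 => i _; apply: lt0r_neq0.
  have : i.+1%:R <= m%:R :> R.
    by rewrite ler_nat (leq_trans (ltn_ord i)).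
  by rewrite -natr1; lra.
move=> h; apply: (mulfI Cz); rewrite mulVKf //.
by apply: (mulIf gz); rewrite -h !mulrA mulfVK.
Qed.

End FallingFactorials.

Local Open Scope complex_scope.

Section EvenHypergeometric.
Variable R : realType.
Implicit Types (a b : seq R).

Lemma ecoef_hypergeoE m b a k : (k <= 2 * m)%N ->
  ecoef (2 * m) (hypergeoE m b a) k =
  if odd k then 0 else (-1) ^+ k./2 * ecoef m (hypergeo m b a) k./2.
Proof.
move=> km; rewrite /ecoef /hypergeoE coef_comp_poly_Xn //.
rewrite dvdn2 oddB // mul2n odd_double /=.
case: (boolP (odd k)) => [ok|/negbTE ok] /=.
  by rewrite mulr0.
rewrite signrMK -signr_odd ok mul1r; congr (_`_ _).
by rewrite -{1}[k]odd_double_half ok add0n -doubleB -mul2n mulKn.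
Qed.

Lemma ecoef_hypergeo m b a k : (k <= m)%N ->
  ecoef m (hypergeo m b a) k =
  ('C(m, k)%:R * falling_seq (scale_seq m b) k
               / falling_seq (scale_seq m a) k)%:C.
Proof. by move=> km; rewrite /hypergeo ecoef_poly_of_ecoef. Qed.

End EvenHypergeometric.

Theorem proposition4p9 (R : realType) (m i1 i2 j1 j2 : nat)
  (a1 : i1.-tuple R) (a2 : i2.-tuple R)
  (b1 : j1.-tuple R) (b2 : j2.-tuple R)
  (m_ge1 : (1 <= m)%N)
  (ha1 : admissible m a1) (ha2 : admissible m a2) :
  ff_mul (2 * m) (hypergeoE m b1 a1) (hypergeoE m b2 a2) =
  hypergeoE m ((- (1 / (2 * m)%:R)) :: b1 ++ b2)
              ((1 - 1 / (2 * m)%:R) :: a1 ++ a2).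
Proof.
rewrite -[RHS](ecoefK (monic_deg_hypergeoE _ _ _)).
apply: eq_bigr => -[k /= /ltnSE k2m] _; congr ((_ * _) *: _).
rewrite !ecoef_hypergeoE //; case: ifP => [|/negbT/even_halfK ek].
  by rewrite mulr0.
have hm : (k./2 <= m)%N by rewrite -leq_double ek -mul2n.
rewrite -{1}ek -mul2n !ecoef_hypergeo //.
rewrite !falling_scale_cons !falling_scale_cat.
move: (k./2) hm => h hm; have := falling_extra_params R m h m_ge1 hm.
set c := falling _ h; set d := falling _ h => /= e.
set B := 'C(m, h)%:R : R in e *.
(* All the scalars are real, so the identity descends from R[i] to R. *)
rewrite (_ : 'C(_, _)%:R^-1 = ('C(2 * m, 2 * h)%:R^-1 : R)%:C); last first.
  by rewrite fmorphV rmorph_nat.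
rewrite (_ : (-1) ^+ h = ((-1) ^+ h : R)%:C); last by rewrite rmorph_sign.
rewrite -!rmorphM; congr (_%:C).
have -> : forall C s x1 y1 x2 y2 : R, C * (s * (B * x1 / y1)) * (s * (B * x2 / y2))
   = s * s * (C * B) * B * (x1 / y1) * (x2 / y2) by move=> *; ring.
rewrite e !invfM -expr2 sqrr_sign; ring.
Qed.
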